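(* Consider the dynamical system for $(x,y,\lambda)$ given in the context, with parameters $\varepsilon\in\{+1,-1\}$, $\xi$, $w_m\neq\frac13$ and function $z(\lambda)$. Suppose $\varepsilon\xi>0$ and that $\lambda_{3b}^*\in I$ satisfies $z(\lambda_{3b}^* )^2=\frac{1}{6\varepsilon\xi}$. Then $(x,y,\lambda)=(0,0,\lambda_{3b}^* )$ is a critical point of the system with $w_{\mathrm{eff}}=\frac13$, and the eigenvalues of the linearization matrix at it are $$l_1=6\xi(1-3w_m),\qquad l_2=12\xi,\qquad l_3=-6\xi,$$ where $l_2$ belongs to the $y$-direction and $l_1,l_3$ belong to the $(x,\lambda)$-plane. In particular, if $\xi>0$ and $w_m<\frac13$, the linearized dynamics in the $(x,\lambda)$-plane is of saddle type.
   Context: Let $\varepsilon\in\{+1,-1\}$ ($+1$ canonical, $-1$ phantom scalar field), $\xi,w_m\in\mathbb{R}$, and let $z:I\to\mathbb{R}$ be a smooth function on an open interval $I$ with nowhere vanishing derivative $z'(\lambda)=\frac{dz}{d\lambda}$ (equivalently $z'(\lambda)=-1/(\lambda^2(\Gamma(\lambda)-1))$ for the function $\Gamma=U''U/U'^2$ determined by the scalar field potential $U$). Put $$D=1-6\varepsilon\xi(1-6\xi)z(\lambda)^2,$$ $$B=-\tfrac43-2\xi\lambda y^2z(\lambda)+\varepsilon(1-6\xi)(1-w_m)x^2+2\varepsilon\xi(1-3w_m)(x+z(\lambda))^2+(1+w_m)(1-y^2).$$ The dynamical system on $\mathbb{R}^2\times I$ is $$\frac{dx}{d\tau}=-\left(x-\tfrac{\varepsilon}{2}\lambda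 y^2\right)D+\tfrac32\left(x+6\xi z(\lambda)\right)B,\qquad \frac{dy}{d\tau}=y\left(2-\tfrac12\lambda x\right)D+\tfrac32\,yB,\qquad \frac{d\lambda}{d\tau}=\frac{x\,D}{z'(\lambda)}.$$ The effective equation of state parameter is $$w_{\mathrm{eff}}=\frac1D\Big[-1+\varepsilon(1-6\xi)(1-w_m)x^2+2\varepsilon\xi(1-3w_m)(x+z)^2+(1+w_m)(1-y^2)-2\varepsilon\xi(1-6\xi)z^2-2\xi y^2\lambda z\Big],\quad z=z(\lambda).$$ *)

(* Defs.v *)
From HB Require Import structures.
From mathcomp Require Import all_boot all_order all_algebra.
From mathcomp Require Import all_classical all_reals all_analysis.

Set Implicit Arguments.
Unset Strict Implicit.
Unset Printing Implicit Defensive.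

Import Order.TTheory GRing.Theory Num.Theory.
Import numFieldNormedType.Exports.

Local Open Scope classical_set_scope.
Local Open Scope ring_scope.

Definition ix : 'I_3 := @Ordinal 3 0 isT.
Definition iy : 'I_3 := @Ordinal 3 1 isT.
Definition il : 'I_3 := @Ordinal 3 2 isT.

Definition point3 (R : realType) (x y l : R) : 'rV[R]_3 :=
  \row_i [eta (fun=> 0) with ix |-> x, iy |-> y, il |-> l] i.

(* A function on the open set I is represented by a total function on R; as I
   is open, its derivatives at the points of I do not depend on the values
   taken outside I. *)
Definition smooth_on (R : realType) (I : set R) (z : R -> R) : Prop :=
  forall (n : nat) (l : R), I l -> derivable (derive1n n z) l 1.

Section system.
Variables (R : realType) (eps xi wm : R) (z : R -> R).

Definition Dfun (l : R) : R := 1 - 6 * eps * xi * (1 - 6 * xi) * z l ^+ 2.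

Definition Bfun (x y l : R) : R :=
  - (4 / 3) - 2 * xi * l * y ^+ 2 * z l
  + eps * (1 - 6 * xi) * (1 - wm) * x ^+ 2
  + 2 * eps * xi * (1 - 3 * wm) * (x + z l) ^+ 2
  + (1 + wm) * (1 - y ^+ 2).

Definition xdot (x y l : R) : R :=
  - (x - eps / 2 * l * y ^+ 2) * Dfun l
  + 3 / 2 * (x + 6 * xi * z l) * Bfun x y l.

Definition ydot (x y l : R) : R :=
  y * (2 - 1 / 2 * l * x) * Dfun l + 3 / 2 * y * Bfun x y l.

Definition ldot (x y l : R) : R := x * Dfun l / derive1 z l.

Definition vector_field (u : 'rV[R]_3) : 'rV[R]_3 :=
  let x := u 0 ix in let y := u 0 iy in let l := u 0 il in
  point3 (xdot x y l) (ydot x y l) (ldot x y l).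

Definition w_eff (x y l : R) : R :=
  (Dfun l)^-1 *
  (- 1 + eps * (1 - 6 * xi) * (1 - wm) * x ^+ 2
   + 2 * eps * xi * (1 - 3 * wm) * (x + z l) ^+ 2
   + (1 + wm) * (1 - y ^+ 2)
   - 2 * eps * xi * (1 - 6 * xi) * z l ^+ 2
   - 2 * xi * y ^+ 2 * l * z l).

End system.

Definition phase_space (R : realType) (I : set R) : set 'rV[R]_3 :=
  [set u | I (u 0 il)].

Definition critical_point (R : realType) (S : set 'rV[R]_3)
    (F : 'rV[R]_3 -> 'rV[R]_3) (p : 'rV[R]_3) : Prop :=
  S p /\ F p = 0.

(* s lists the eigenvalues of A, repeated according to their algebraic
   multiplicities; in particular all complex eigenvalues of A are real. *)
Definition eigenvalues_are (R : realType) (n : nat) (A : 'M[R]_n) (s : seq R)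
    : Prop :=
  (forall a, eigenvalue A a = (a \in s)) /\
  char_poly A = \prod_(a <- s) ('X - a%:P).

(* Matrices act on row vectors on the right, as in jacobian: the (i, j) entry
   of the linearization matrix is the derivative of the j-th component of the
   field with respect to the i-th variable, and eigenvectors are rows. *)
Definition xl_index (i : 'I_2) : 'I_3 := if i == ord0 then ix else il.

Definition xl_plane (R : realType) : 'M[R]_(2, 3) := rowsub xl_index 1%:M.

(* When xl_plane is stable under A, this is the matrix of the restriction of A
   to that plane, in the basis of the x- and lambda-directions. *)
Definition xl_restriction (R : realType) (A : 'M[R]_3) : 'M[R]_2 :=
  mxsub xl_index xl_index A.

Definition saddle_type (R : realType) (A : 'M[R]_2) : Prop :=
  exists a b : R, [/\ a < 0, 0 < b, eigenvalue A a & eigenvalue A b].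

(* Main.v *)
(* Write q = 6 xi (1 - 3 wm). At the point, z^2 = 1 / (6 eps xi) gives B = 0 and
   D = 6 xi, so only the variation of B contributes to the linearization of the
   terms multiplied by B, and the x factor of ldot removes the derivatives of D
   and of 1 / z'. The gradients of the components in (x, y, lambda) are therefore
     xdot : (q - 6 xi, 0, q z'),  ydot : (0, 12 xi, 0),  ldot : (6 xi / z', 0, 0).
   The y-direction decouples, and the (x, lambda)-block has trace q - 6 xi and
   determinant - 6 xi q. *)
Require Import Defs.
From HB Require Import structures.
From mathcomp Require Import all_boot all_order all_algebra.
From mathcomp Require Import all_classical all_reals all_analysis.
From mathcomp Require Import ring lra.

Import Order.TTheory GRing.Theory Num.Theory.
Import numFieldNormedType.Exports.

Local Open Scope classical_set_scope.
Local Open Scope ring_scope.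

(** * Characteristic polynomials of small and decoupled matrices *)

Lemma eigenvalues_are_char_poly (R : realType) (n : nat) (A : 'M[R]_n)
    (s : seq R) :
  char_poly A = \prod_(a <- s) ('X - a%:P) -> eigenvalues_are A s.
Proof.
by move=> As; split=> // a; rewrite eigenvalue_root_char As root_prod_XsubC.
Qed.

(** Vieta: trace and determinant fix the monic quadratic, so guessed roots are checked without
    extracting square roots. *)
Lemma char_poly_mx22 (R : comNzRingType) (A : 'M[R]_2) (a b : R) :
  A 0 0 + A 1 1 = a + b -> A 0 0 * A 1 1 - A 0 1 * A 1 0 = a * b ->
  char_poly A = ('X - a%:P) * ('X - b%:P).
Proof.
move=> tA dA.
have lift01 : lift (0 : 'I_2) (0 : 'I_1) = 1 by apply/val_inj.
have lift10 : lift (1 : 'I_2) (0 : 'I_1) = 0 by apply/val_inj.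
have -> : ('X - a%:P) * ('X - b%:P) =
    'X * 'X - (a + b)%:P * 'X + (a * b)%:P :> {poly R}.
  by rewrite polyCD polyCM; ring.
rewrite -tA -dA polyCD polyCB !polyCM /char_poly (expand_det_row _ 0).
rewrite !big_ord_recl big_ord0 /cofactor !det_mx11 !mxE /= !lift01 !lift10.
rewrite ?eqxx ?mulr1n ?mulr0n /bump /= ?expr0 ?expr1.
ring.
Qed.

(** Laplace expansion along row [i] leaves only the diagonal term, with sign
    [(-1) ^+ (i + i) = 1]. *)
Lemma char_poly_decoupled (R : comNzRingType) (n : nat) (A : 'M[R]_n) (i : 'I_n) :
  (forall j, j != i -> A i j = 0) ->
  char_poly A = ('X - (A i i)%:P) * char_poly (row' i (col' i A)).
Proof.
move=> Ai0; rewrite /char_poly (expand_det_row _ i) (bigD1 i) //= big1 => [|j ji].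
  rewrite addr0 /cofactor row'_col'_char_poly_mx -signr_odd oddD addbb expr0.
  by rewrite mul1r !mxE eqxx mulr1n.
by rewrite !mxE eq_sym (negbTE ji) Ai0 // polyC0 mulr0n subr0 mul0r.
Qed.

Lemma ord3P (j : 'I_3) : [\/ j = ix, j = iy | j = il].
Proof.
by case: j => [[|[|[|//]]] ?]; [apply: Or31|apply: Or32|apply: Or33]; apply/val_inj.
Qed.

(** [xl_index] lists the indices other than [iy] in increasing order, as [lift iy] does; the block
    is thus the minor left by [char_poly_decoupled]. *)
Lemma xl_restrictionE (R : realType) (A : 'M[R]_3) :
  xl_restriction A = row' iy (col' iy A).
Proof.
apply/matrixP => i j; rewrite !mxE.
by congr (A _ _); apply/val_inj; [case: i => [[|[|[]]]] | case: j => [[|[|[]]]]].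
Qed.

(** * Differentials of row-valued maps and their Jacobian entries *)

Lemma differentiable_rowP (R : realType) (V : normedModType R) (n : nat)
    (f : V -> 'rV[R]_n) (p : V) :
  (forall j, differentiable (fun u => f u 0 j) p) -> differentiable f p.
Proof.
move=> df.
have -> : f = \sum_(j < n) (fun u => f u 0 j *: delta_mx 0 j).
  by apply/funext => u; rewrite fct_sumE [LHS]row_sum_delta.
by apply: differentiable_sum => j; exact: differentiableZl.
Qed.

Lemma is_diff_coord (R : realType) (m n : nat) (M : 'M[R]_(m, n)) i j :
  is_diff M (fun N : 'M[R]_(m, n) => N i j : R) (fun N => N i j).
Proof.
pose c (w : 'M[R]_(m, n)) : R := w i j.
have clin : linear c by move=> a u v; rewrite /c !mxE.
pose cM := GRing.isLinear.Build _ _ _ _ c clin.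
pose cL : {linear _ -> _} := HB.pack c cM.
have cc : continuous cL by exact: coord_continuous.
apply: DiffDef; first exact: differentiable_coord.
by rewrite -/c (_ : c = cL) // diff_lin.
Qed.

(** Chain rule with a coordinate form: Jacobian entries reduce to differentials of scalar
    components. *)
Lemma jacobian_coord (R : realType) (m n : nat) (f : 'rV[R]_m -> 'rV[R]_n)
    (p : 'rV[R]_m) (i : 'I_m) (j : 'I_n) :
  differentiable f p ->
  jacobian f p i j = 'd (fun u => f u 0 j) p (delta_mx 0 i).
Proof.
move=> /differentiableP df; rewrite !mxE.
have dc := is_diff_coord _ _ _ (f p) 0 j.
have dcf : is_diff p (fun u => f u 0 j) _ := is_diff_comp df dc.
by rewrite (diff_val (is_diff_def := dcf)).
Qed.

Lemma is_diffV (R : realType) (V : normedModType R) (f df : V -> R) (x : V) :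
  is_diff x f df -> f x != 0 ->
  is_diff x (fun y => (f y)^-1) (- (f x) ^- 2 *: df).
Proof.
move=> dfx fx0; apply: DiffDef; first exact: differentiableV.
by rewrite diffV // diff_val.
Qed.

Lemma is_diff_derive1 (R : realType) (f : R -> R) (x : R) :
  derivable f x 1 -> is_diff x f ( *:%R^~ (derive1 f x)).
Proof.
by move=> df; apply: DiffDef; [exact/derivable1_diffP | rewrite deriv1E].
Qed.

Lemma point3x (R : realType) (x y l : R) : point3 x y l 0 ix = x.
Proof. by rewrite mxE. Qed.
Lemma point3y (R : realType) (x y l : R) : point3 x y l 0 iy = y.
Proof. by rewrite mxE. Qed.
Lemma point3l (R : realType) (x y l : R) : point3 x y l 0 il = l.
Proof. by rewrite mxE. Qed.

(** * Differentials of the three components at the critical point *)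

Section linearization.
Variables (R : realType) (eps xi wm : R) (z : R -> R) (lam : R).
Hypothesis xi0 : eps * xi != 0.
Hypothesis hlam : z lam ^+ 2 = 1 / (6 * eps * xi).
Hypothesis dz : derivable z lam 1.
Hypothesis dz' : derivable (derive1 z) lam 1.
Hypothesis z'0 : derive1 z lam != 0.

Let p := point3 0 0 lam.
Let F := vector_field eps xi wm z.
Let q : R := 6 * xi * (1 - 3 * wm).

(** The form in which the hypothesis on [z lam] is used: the square occurs below together with
    [eps * xi], and replacing the product avoids dividing by parameters. *)
Lemma critical_z_sqr : eps * xi * z lam ^+ 2 = 1 / 6.
Proof.
move: xi0; rewrite hlam mulf_eq0 negb_or => /andP[e0 x0].
by field; rewrite e0 x0.
Qed.

Lemma Dfun_critical : Dfun eps xi z lam = 6 * xi.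
Proof.
transitivity (1 - 6 * (1 - 6 * xi) * (eps * xi * z lam ^+ 2)).
  by rewrite /Dfun; ring.
by rewrite critical_z_sqr; field.
Qed.

Lemma Bfun_critical : Bfun eps xi wm z 0 0 lam = 0.
Proof.
transitivity (- (4 / 3) + 2 * (1 - 3 * wm) * (eps * xi * z lam ^+ 2) + (1 + wm)).
  by rewrite /Bfun; ring.
by rewrite critical_z_sqr; field.
Qed.

Let zero_fctE (u : 'rV[R]_3) : (0 : 'rV[R]_3 -> R) u = 0. Proof. by []. Qed.

(** With coordinates as functions, each component becomes a pointwise expression to which the sum,
    product and chain rules apply. *)
Let X (u : 'rV[R]_3) : R := u 0 ix.
Let Y (u : 'rV[R]_3) : R := u 0 iy.
Let L (u : 'rV[R]_3) : R := u 0 il.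
Let dX : is_diff p X X. Proof. exact: is_diff_coord. Qed.
Let dY : is_diff p Y Y. Proof. exact: is_diff_coord. Qed.
Let dL : is_diff p L L. Proof. exact: is_diff_coord. Qed.
Let dC (c : R) : is_diff p (cst c) (0 : 'rV[R]_3 -> R). Proof. exact: is_diff_cst. Qed.
Let Xp : X p = 0. Proof. exact: point3x. Qed.
Let Yp : Y p = 0. Proof. exact: point3y. Qed.
Let Lp : L p = lam. Proof. exact: point3l. Qed.

Let dZ : is_diff p (z \o L) (derive1 z lam *: L).
Proof.
have dzL : is_diff (L p) z ( *:%R^~ (derive1 z lam)).
  by rewrite Lp; exact: is_diff_derive1.
apply: (is_diff_eq (is_diff_comp dL dzL)).
apply/funext => u /=.
by rewrite /GRing.scale /= mulrC.
Qed.

Let dD : is_diff p (Dfun eps xi z \o L)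
  (- (12 * eps * xi * (1 - 6 * xi) * z lam * derive1 z lam) *: L).
Proof.
have -> : Dfun eps xi z \o L =
    cst 1 - (6 * eps * xi * (1 - 6 * xi)) *: (z \o L) ^+ 2.
  by apply/funext.
(* The index of [is_diffX] is one less than the exponent: 1 stands for the square. *)
apply: (is_diff_eq (is_diffB (dC 1)
    (is_diffZ (6 * eps * xi * (1 - 6 * xi)) (is_diffX 1 dZ)))).
apply/funext => u /=.
rewrite !fctE /= ?zero_fctE Lp /GRing.scale /=; ring.
Qed.

(** The terms in [X ^+ 2] and [Y ^+ 2] have zero differential at [p]; only [(x + z) ^+ 2]
    contributes. *)
Let dB : is_diff p (fun u => Bfun eps xi wm z (X u) (Y u) (L u))
  ((4 * eps * xi * (1 - 3 * wm) * z lam) *: (X + derive1 z lam *: L)).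
Proof.
have -> : (fun u => Bfun eps xi wm z (X u) (Y u) (L u)) =
    cst (- (4 / 3)) - (2 * xi) *: (L * Y ^+ 2 * (z \o L))
    + (eps * (1 - 6 * xi) * (1 - wm)) *: X ^+ 2
    + (2 * eps * xi * (1 - 3 * wm)) *: (X + (z \o L)) ^+ 2
    + (1 + wm) *: (cst 1 - Y ^+ 2).
  apply/funext => u; rewrite /Bfun !fctE /GRing.scale /=; ring.
apply: (is_diff_eq (is_diffD (is_diffD (is_diffD (is_diffB (dC (- (4 / 3)))
      (is_diffZ (2 * xi) (is_diffM (is_diffM dL (is_diffX 1 dY)) dZ)))
    (is_diffZ (eps * (1 - 6 * xi) * (1 - wm)) (is_diffX 1 dX)))
    (is_diffZ (2 * eps * xi * (1 - 3 * wm)) (is_diffX 1 (is_diffD dX dZ))))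
    (is_diffZ (1 + wm) (is_diffB (dC 1) (is_diffX 1 dY))))).
apply/funext => u /=.
rewrite !fctE /= ?zero_fctE Xp Yp Lp /GRing.scale /=; ring.
Qed.

Lemma is_diff_xdot : is_diff p (fun u => F u 0 ix)
  ((q - 6 * xi) *: X + (q * derive1 z lam) *: L).
Proof.
have -> : (fun u => F u 0 ix) =
    (3 / 2) *: ((X + (6 * xi) *: (z \o L))
       * (fun u => Bfun eps xi wm z (X u) (Y u) (L u)))
    - (X - (eps / 2) *: (L * Y ^+ 2)) * (Dfun eps xi z \o L).
  apply/funext => u; rewrite /F /vector_field point3x /xdot !fctE /GRing.scale /=.
  by rewrite -/(X u) -/(Y u) -/(L u); ring.
apply: (is_diff_eq (is_diffB
    (is_diffZ (3 / 2) (is_diffM (is_diffD dX (is_diffZ (6 * xi) dZ)) dB))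
    (is_diffM (is_diffB dX (is_diffZ (eps / 2) (is_diffM dL (is_diffX 1 dY)))) dD))).
apply/funext => u /=.
rewrite !fctE /= ?zero_fctE Xp Yp Lp Bfun_critical Dfun_critical /GRing.scale /= /q.
(* The factor 36 is 3/2 * 6 * 4, from [3 / 2 * 6 * xi * z] times the differential of B; grouping
   [eps * xi * z ^+ 2], equal to 1/6, turns the coefficient into [q]. *)
transitivity (36 * xi * (1 - 3 * wm) * (eps * xi * z lam ^+ 2)
  * (X u + derive1 z lam * L u) - 6 * xi * X u); first by field.
by rewrite critical_z_sqr; field.
Qed.

(** Both terms carry the factor y, zero at [p]; what remains is [2 * D + 3 / 2 * B = 12 * xi] times
    [Y]. *)
Lemma is_diff_ydot : is_diff p (fun u => F u 0 iy) ((12 * xi) *: Y).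
Proof.
have -> : (fun u => F u 0 iy) =
    Y * (cst 2 - (1 / 2) *: (L * X)) * (Dfun eps xi z \o L)
    + (3 / 2) *: (Y * (fun u => Bfun eps xi wm z (X u) (Y u) (L u))).
  apply/funext => u; rewrite /F /vector_field point3y /ydot !fctE /GRing.scale /=.
  by rewrite -/(X u) -/(Y u) -/(L u); ring.
apply: (is_diff_eq (is_diffD
    (is_diffM (is_diffM dY (is_diffB (dC 2)
      (is_diffZ (1 / 2) (is_diffM dL dX)))) dD)
    (is_diffZ (3 / 2) (is_diffM dY dB)))).
apply/funext => u /=.
rewrite !fctE /= ?zero_fctE Xp Yp Lp Bfun_critical Dfun_critical /GRing.scale /=.
by field.
Qed.

Lemma is_diff_ldot : is_diff p (fun u => F u 0 il)
  ((6 * xi / derive1 z lam) *: X).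
Proof.
(* The second derivative of [z] makes 1/z' differentiable; its value is then multiplied by
   [X p = 0]. *)
have dz'L : is_diff (L p) (derive1 z) ( *:%R^~ (derive1 (derive1 z) lam)).
  by rewrite Lp; exact: is_diff_derive1.
have z'L0 : (derive1 z \o L) p != 0 by rewrite /= Lp.
have dV := is_diffV _ _ _ _ _ (is_diff_comp dL dz'L) z'L0.
have -> : (fun u => F u 0 il) =
    X * (Dfun eps xi z \o L) * (fun u => ((derive1 z \o L) u)^-1).
  by apply/funext => u; rewrite /F /vector_field point3l.
apply: (is_diff_eq (is_diffM (is_diffM dX dD) dV)).
apply/funext => u /=.
rewrite !fctE /= ?zero_fctE Xp Lp Dfun_critical /GRing.scale /=.
by field.
Qed.

Lemma differentiable_vector_field : differentiable F p.
Proof.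
apply: differentiable_rowP => j; case: (ord3P j) => ->.
- by have [] := is_diff_xdot.
- by have [] := is_diff_ydot.
- by have [] := is_diff_ldot.
Qed.

(** * Entries, spectrum and invariant plane of the Jacobian *)

Lemma jacobian_x (i : 'I_3) : jacobian F p i ix =
  (q - 6 * xi) * (i == ix)%:R + q * derive1 z lam * (i == il)%:R.
Proof.
rewrite jacobian_coord; last exact: differentiable_vector_field.
have dF := is_diff_xdot; rewrite diff_val !fctE /GRing.scale /= /X /L !mxE.
by rewrite ![_ == i]eq_sym.
Qed.

Lemma jacobian_y (i : 'I_3) : jacobian F p i iy = 12 * xi * (i == iy)%:R.
Proof.
rewrite jacobian_coord; last exact: differentiable_vector_field.
have dF := is_diff_ydot; rewrite diff_val !fctE /GRing.scale /= /Y !mxE.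
by rewrite ![_ == i]eq_sym.
Qed.

Lemma jacobian_l (i : 'I_3) :
  jacobian F p i il = 6 * xi / derive1 z lam * (i == ix)%:R.
Proof.
rewrite jacobian_coord; last exact: differentiable_vector_field.
have dF := is_diff_ldot; rewrite diff_val !fctE /GRing.scale /= /X !mxE.
by rewrite ![_ == i]eq_sym.
Qed.

(** The off-diagonal entries [q * z'] and [6 * xi / z'] multiply to [6 * xi * q], so z' leaves no
    trace in the eigenvalues. *)
Lemma char_poly_xl_restriction : char_poly (xl_restriction (jacobian F p)) =
  ('X - q%:P) * ('X - (- (6 * xi))%:P).
Proof.
have xl0 : xl_index 0 = ix by [].
have xl1 : xl_index 1 = il by [].
have JE i j : xl_restriction (jacobian F p) i j =
    jacobian F p (xl_index i) (xl_index j) by rewrite [LHS]mxE.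
apply: char_poly_mx22; rewrite !JE !xl0 !xl1 !jacobian_x !jacobian_l /=; first by ring.
by field.
Qed.

Lemma char_poly_jacobian : char_poly (jacobian F p) =
  ('X - q%:P) * ('X - (12 * xi)%:P) * ('X - (- (6 * xi))%:P).
Proof.
rewrite (@char_poly_decoupled _ _ _ iy) => [|j].
  rewrite -xl_restrictionE char_poly_xl_restriction jacobian_y eqxx mulr1.
  by rewrite mulrCA mulrA.
by case: (ord3P j) => -> // _; rewrite ?jacobian_x ?jacobian_l /= !mulr0 ?addr0.
Qed.

Lemma jacobian_y_direction :
  delta_mx 0 iy *m jacobian F p = (12 * xi) *: (delta_mx 0 iy : 'rV[R]_3).
Proof.
rewrite -rowE; apply/rowP => j; rewrite [LHS]mxE [RHS]mxE [delta_mx _ _ _ _]mxE eqxx /=.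
case: (ord3P j) => ->; first by rewrite jacobian_x /= !mulr0 addr0.
  by rewrite jacobian_y.
by rewrite jacobian_l /= !mulr0.
Qed.

Lemma stable_xl_plane_jacobian : stablemx (xl_plane R) (jacobian F p).
Proof.
apply/row_subP => i; rewrite /xl_plane mul_rowsub_mx mul1mx.
(* The plane consists of the rows with zero y-entry, and the y-column of the Jacobian vanishes off
   the diagonal. *)
have rE (u : 'rV[R]_3) : u 0 iy = 0 -> (u <= rowsub xl_index 1%:M)%MS.
  move=> uy; apply/submxP; exists (\row_k u 0 (xl_index k)).
  apply/rowP => j; rewrite !mxE !big_ord_recl big_ord0 !mxE.
  by case: (ord3P j) => -> /=; rewrite ?mulr1 ?mulr0 ?addr0 ?add0r ?uy.
by apply: rE; rewrite mxE mxE jacobian_y; case: i => [[|[|[]]]] //= _; rewrite mulr0.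
Qed.

End linearization.

Theorem mainTheorem3 (R : realType) (eps xi wm : R) (I : set R) (z : R -> R)
    (lam : R)
    (heps : eps = 1 \/ eps = -1)
    (hwm : wm <> 1 / 3)
    (hIopen : open I) (hIitv : is_interval I)
    (hz : smooth_on I z)
    (hz' : forall l : R, I l -> derive1 z l <> 0)
    (hpos : 0 < eps * xi)
    (hlamI : I lam)
    (hlam : z lam ^+ 2 = 1 / (6 * eps * xi)) :
  let F := vector_field eps xi wm z in
  let p := point3 0 0 lam in
  let J := jacobian F p in
  let l1 := 6 * xi * (1 - 3 * wm) in
  let l2 := 12 * xi in
  let l3 := - (6 * xi) in
  [/\ critical_point (phase_space I) F p,
      w_eff eps xi wm z 0 0 lam = 1 / 3,
      differentiable F p /\ eigenvalues_are J [:: l1; l2; l3],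
      delta_mx 0 iy *m J = l2 *: (delta_mx 0 iy : 'rV[R]_3) /\
      (stablemx (xl_plane R) J /\
       eigenvalues_are (xl_restriction J) [:: l1; l3])
    & 0 < xi -> wm < 1 / 3 -> saddle_type (xl_restriction J)].
Proof.
move=> F p J l1 l2 l3.
have epsxi0 : eps * xi != 0 by rewrite gt_eqF.
(* Index [n] of [smooth_on] concerns derivability of the n-th derivative, so 1 yields the second
   derivative. *)
have dz : derivable z lam 1 by exact: (hz 0%N).
have dz' : derivable (derive1 z) lam 1 by exact: (hz 1%N).
have z'0 : derive1 z lam != 0 by apply/eqP; exact: hz'.
have xi0 : xi != 0 by move: epsxi0; rewrite mulf_eq0 negb_or => /andP[].
have xl_eig : eigenvalues_are (xl_restriction J) [:: l1; l3].
  apply: eigenvalues_are_char_poly.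
  by rewrite char_poly_xl_restriction // !big_cons big_nil mulr1.
split.
- split; first by rewrite /phase_space /= point3l.
  rewrite /F /vector_field /xdot /ydot /ldot point3x point3y point3l.
  (* Every term has a factor x, y or B, all zero here. *)
  rewrite Bfun_critical //; apply/rowP => j; rewrite [RHS]mxE.
  by case: (ord3P j) => ->; rewrite ?(point3x, point3y, point3l); ring.
- rewrite /w_eff Dfun_critical //.
  (* The bracket equals [wm + (6 * xi - 3 * wm) / 3 = 2 * xi], to be divided by [D = 6 * xi]. *)
  transitivity ((6 * xi)^-1 *
      (wm + 2 * (6 * xi - 3 * wm) * (eps * xi * z lam ^+ 2))).
    by congr (_ * _); ring.
  by rewrite (critical_z_sqr _ _ _ _ _ epsxi0 hlam); field.
- split; first exact: differentiable_vector_field.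
  apply: eigenvalues_are_char_poly.
  by rewrite char_poly_jacobian // !big_cons big_nil mulr1 mulrA.
- split; first exact: jacobian_y_direction.
  by split; first exact: stable_xl_plane_jacobian.
- move=> xi_gt0 wm_lt; exists l3, l1; split.
  + by rewrite /l3; lra.
  + by rewrite /l1; apply: mulr_gt0; lra.
  + by rewrite xl_eig.1 !inE eqxx orbT.
  + by rewrite xl_eig.1 !inE eqxx.
Qed.
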